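(* Let $p<q$ be distinct primes. Then the zero-divisor graph $\Gamma(\mathbb{Z}_{p^2q^2})$ is not Hamiltonian.
   Context: For a finite commutative ring $R$ with unity, the zero-divisor graph $\Gamma(R)$ has vertex set the nonzero zero-divisors of $R$, with distinct $x,y$ adjacent iff $xy=0$. A graph of order $N$ is Hamiltonian if it contains a cycle of length $N$. *)

(* Defs.v *)
(* A finite simple graph is given by an adjacency relation on a
   finType of vertices. *)
From HB Require Import structures.
From mathcomp Require Import all_boot all_order all_algebra.

Set Implicit Arguments.
Unset Strict Implicit.
Unset Printing Implicit Defensive.

Import GRing.Theory.

Definition is_graph_cycle (V : finType) (e : rel V) (c : seq V) : Prop :=
  [/\ 2 < size c, uniq c & cycle e c].

Definition hamiltonian (V : finType) (e : rel V) : Prop :=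
  exists c : seq V, is_graph_cycle e c /\ size c = #|V|.

Section ZeroDivisorGraph.

Local Open Scope ring_scope.

Variable R : finComNzRingType.

Definition zero_divisor (x : R) : bool := [exists y : R, (y != 0) && (x * y == 0)].

Definition zdg_vertex : finType := {x : R | (x != 0) && zero_divisor x}.

Definition zdg_adj : rel zdg_vertex :=
  fun x y => (x != y) && (val x * val y == 0).

Lemma zdg_adj_sym : symmetric zdg_adj.
Proof. by move=> x y; rewrite /zdg_adj eq_sym mulrC. Qed.

Lemma zdg_adj_irr : irreflexive zdg_adj.
Proof. by move=> x; rewrite /zdg_adj eqxx. Qed.

End ZeroDivisorGraph.

Arguments zdg_vertex : clear implicits.
Arguments zdg_adj : clear implicits.

(* Main.v *)
(** In a Hamiltonian graph the successor map along the cycle is injective, so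
    every family of vertices is injected into its neighbours.  For
    [0 <= j < q] the residue [p + j p^2 q] is [p] times an integer coprime to
    [p q], so its annihilator modulo [p^2 q^2] is the ideal generated by
    [p q^2], which has only [p < q] elements. *)
Require Import Defs.
From HB Require Import structures.
From mathcomp Require Import all_boot all_order all_algebra.

(** A repetition-free cycle of length [#|V|] visits every vertex, so the default value of [next c]
    off the cycle never occurs; [prev c] inverts [next c]. *)
Lemma hamiltonian_injective_successor (V : finType) (e : rel V) :
  hamiltonian e -> exists2 s : V -> V, injective s & forall x, e x (s x).
Proof.
move=> [c [[_ Uc Cc] szc]]; exists (next c).
  exact: can_inj (prev_next Uc).
move=> x; apply: next_cycle Cc _.
have [|||_ ->] := @uniq_min_size _ c (enum V) => //; last by rewrite mem_enum.
- by move=> y _; rewrite mem_enum.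
- by rewrite -cardE szc.
Qed.

Lemma Zp_mul_eq0 (n : nat) (x y : 'Z_n) :
  1 < n -> (x * y == 0)%R = (n %| x * y).
Proof. move=> n1; transitivity ((Zp_trunc n).+2 %| x * y); first by rewrite -val_eqE.
by congr (_ %| _); rewrite Zp_cast. Qed.

Lemma Zp_eq0 (n : nat) (x : 'Z_n) : (x == 0)%R = (x == 0 :> nat).
Proof. by rewrite -val_eqE. Qed.

(** Cancelling one [p] leaves the factor [j * p * q + 1], coprime to [p * q ^ 2], which Gauss's
    lemma removes. *)
Lemma mul_annihilator_dvd (p q j y : nat) : 0 < p ->
  p ^ 2 * q ^ 2 %| (p + j * (p ^ 2 * q)) * y -> p * q ^ 2 %| y.
Proof.
move=> p0.
have -> : p + j * (p ^ 2 * q) = p * (j * p * q).+1.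
  by rewrite mulnS -!mulnn; congr (_ + _); rewrite !mulnA [p * j]mulnC.
rewrite -mulnn -(mulnA p p) -(mulnA p _ y) dvdn_pmul2l // Gauss_dvdr //.
rewrite -mulnn !coprimeMl andbb.
have cop d : d %| j * p * q -> coprime d (j * p * q).+1.
  by move=> dv; rewrite coprime_sym; apply: coprime_dvdr dv (coprimeSn _).
rewrite (cop q) ?dvdn_mull // andbT; apply: cop.
by rewrite mulnAC dvdn_mull.
Qed.

Theorem theorem2p8 (p q : nat) (hp : prime p) (hq : prime q) (hpq : p < q) :
  ~ hamiltonian (zdg_adj 'Z_(p ^ 2 * q ^ 2)).
Proof.
move=> /hamiltonian_injective_successor[s s_inj adj_s].
have [p0 q0 p1] : [/\ 0 < p, 0 < q & 1 < p] by rewrite !prime_gt0 ?prime_gt1.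
set n := p ^ 2 * q ^ 2 in s s_inj adj_s *.
have nE : n = q * (p ^ 2 * q) by rewrite /n mulnCA mulnn.
have nE' : n = p * (p * q ^ 2) by rewrite /n mulnA mulnn.
have m0 : 0 < p ^ 2 * q by rewrite muln_gt0 expn_gt0 p0.
have d0 : 0 < p * q ^ 2 by rewrite muln_gt0 expn_gt0 p0 q0.
have p_lt : p < p ^ 2 * q.
  by rewrite -mulnn -mulnA ltn_Pmulr // (leq_trans p1) // leq_pmulr.
have n1 : 1 < n.
  by rewrite nE (leq_trans p1) // (leq_trans (ltnW p_lt)) // leq_pmull.
(* As [p < p ^ 2 * q], the value is below [(j + 1) * (p ^ 2 * q) <= n]: no reduction modulo [n]
   occurs. *)
have x_lt (j : 'I_q) : p + j * (p ^ 2 * q) < (Zp_trunc n).+2.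
  by rewrite Zp_cast // nE (@leq_trans (j.+1 * (p ^ 2 * q))) ?leq_mul2r ?ltn_ord
    ?orbT // mulSn ltn_add2r.
pose x j : 'Z_n := Ordinal (x_lt j).
have y_lt : p * q ^ 2 < (Zp_trunc n).+2 by rewrite Zp_cast // nE' ltn_Pmull.
have xP j : ((x j != 0) && zero_divisor (x j))%R.
  rewrite Zp_eq0 /= addn_eq0 eqn0Ngt p0 /=.
  (* The witness [p * q ^ 2] sends both [p] and [p ^ 2 * q] to multiples of [n]. *)
  apply/existsP; exists (Ordinal y_lt : 'Z_n).
  rewrite Zp_eq0 -lt0n d0 Zp_mul_eq0 //=.
  by rewrite mulnDl -nE' dvdn_addr // -mulnA [p * _]mulnC mulnACA dvdn_mull //
    dvdn_mulr.
pose f j : zdg_vertex 'Z_n := Sub (x j) (xP j).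
pose y j : nat := val (s (f j)).
have dy j : p * q ^ 2 %| y j.
  have /andP[_] := adj_s (f j); rewrite Zp_mul_eq0 //=.
  exact: mul_annihilator_dvd.
have t_lt j : y j %/ (p * q ^ 2) < p.
  by rewrite ltn_divLR // -nE' -[X in _ < X]Zp_cast // ltn_ord.
(* Since [p * q ^ 2] divides [y j], the quotient determines [y j], hence [f j] by injectivity of
   [s], hence [j]. So [q] indices would inject into [p] quotients. *)
have t_inj : injective (fun j => Ordinal (t_lt j)).
  move=> i j /(congr1 val) /= tE.
  have /val_inj/val_inj/s_inj/(congr1 val)/(congr1 val)/= : y i = y j.
    by rewrite -(divnK (dy i)) tE divnK.
  by move/addnI/eqP; rewrite eqn_pmul2r // => /eqP/val_inj.
by have := leq_card _ t_inj; rewrite !card_ord leqNgt hpq.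
Qed.
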